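(* For every integer $d \geq 1$ there exists a strictly antipodal set in $\mathbb{R}^d$ of cardinality $2^{d-1}+1$.
   Context: A set of points in $\mathbb{R}^d$ is called strictly antipodal if for any two distinct points $x$ and $y$ of the set there are parallel hyperplanes $H_x$ and $H_y$ passing through $x$ and $y$, respectively, such that all other points of the set lie strictly between $H_x$ and $H_y$. (Hyperplanes are affine subspaces of dimension $d-1$.) *)

(* Defs.v *)
From HB Require Import structures.
From mathcomp Require Import all_boot all_order all_algebra.
From mathcomp Require Import all_classical all_reals.

Set Implicit Arguments.
Unset Strict Implicit.
Unset Printing Implicit Defensive.

Import Order.TTheory GRing.Theory Num.Theory.

Local Open Scope classical_set_scope.
Local Open Scope ring_scope.

Section StrictlyAntipodal.
Context {R : realType} {d : nat}.
Implicit Types (V : {vspace 'rV[R]_d}) (H S : set 'rV[R]_d).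

Definition affine_subspace (p : 'rV[R]_d) V : set 'rV[R]_d :=
  [set z | z - p \in V].

Definition hyperplane H : Prop :=
  exists p V, (\dim V).+1 = d /\ H = affine_subspace p V.

Definition parallel H1 H2 : Prop :=
  exists V p1 p2, H1 = affine_subspace p1 V /\ H2 = affine_subspace p2 V.

(* The open slab between H1 and H2 when these are parallel hyperplanes. If they
   are distinct, the last two conjuncts follow from the first; if they coincide,
   those conjuncts make the slab empty. *)
Definition strictly_between H1 H2 (z : 'rV[R]_d) : Prop :=
  [/\ exists a b (t : R),
        [/\ H1 a, H2 b, 0 < t < 1 & z = (1 - t) *: a + t *: b],
      ~ H1 z & ~ H2 z].

Definition strictly_antipodal S : Prop :=
  forall x y, S x -> S y -> x <> y ->
    exists Hx Hy : set 'rV[R]_d,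
      [/\ hyperplane Hx /\ hyperplane Hy, parallel Hx Hy, Hx x /\ Hy y &
          forall z, S z -> z <> x -> z <> y -> strictly_between Hx Hy z].

End StrictlyAntipodal.

(* Main.v *)
(* A set in which every angle [y x z] is acute is strictly antipodal: use the
   hyperplanes through x and y orthogonal to [y - x]. To get 2^(d-1) + 1 points
   with only acute angles, take the vertices of the cube {-1,1}^n, n = d - 1, in
   R^n x R. The cube has no obtuse angle, but many right ones. Move the vertices
   one after the other: raise the vertex v by h_v in the extra direction and
   contract it towards the centre by the factor [1 - h_v^2 / (4 (n + 1))], where
   every h_v is much smaller than the previous ones. The first vertex of a right
   angle to be moved makes the angle acute: when it is the corner of the angle,
   the gain h_v^2 from the height exceeds the loss from the contraction;
   otherwise the contraction gains while the height has no effect. Later moves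
   are too small to undo this. Finally, a point high above the centre of the
   cube forms only acute angles with the vertices. *)
From HB Require Import structures.
Require Import Defs.
From mathcomp Require Import all_boot all_order all_algebra.
From mathcomp Require Import all_classical all_reals.
From mathcomp Require Import ring lra.

Set Implicit Arguments.
Unset Strict Implicit.
Unset Printing Implicit Defensive.

Import Order.TTheory GRing.Theory Num.Theory.

Local Open Scope classical_set_scope.
Local Open Scope ring_scope.

(** * Dot product and orthogonal hyperplanes *)

Definition dot (R : realType) (d : nat) (u v : 'rV[R]_d) : R :=
  \sum_i u 0 i * v 0 i.

Lemma dotC (R : realType) d (u v : 'rV[R]_d) : dot u v = dot v u.
Proof. by apply: eq_bigr => i _; rewrite mulrC. Qed.

(** The codomain [R^o] is the field as a vector space over itself, so that [linfun] and [lker] apply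
    to the form. *)
Lemma dot_linear (R : realType) d (u : 'rV[R]_d) :
  linear (dot u : 'rV[R]_d -> R^o).
Proof.
move=> a v w; rewrite /dot scaler_sumr -big_split /=; apply: eq_bigr => i _.
by rewrite !mxE mulrDr mulrCA.
Qed.

HB.instance Definition _ (R : realType) d (u : 'rV[R]_d) :=
  GRing.isLinear.Build R 'rV[R]_d R^o *:%R (dot u) (dot_linear u).

Lemma dot_self_gt0 (R : realType) d (u : 'rV[R]_d) : u != 0 -> 0 < dot u u.
Proof.
move=> u0; rewrite lt0r sumr_ge0 ?andbT; last first.
  by move=> i _; rewrite -expr2 sqr_ge0.
apply: contra u0 => /eqP/psumr_eq0P s0; apply/eqP/rowP => i; rewrite mxE.
apply/eqP; rewrite -sqrf_eq0 expr2 s0 // => j _.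
by rewrite -expr2 sqr_ge0.
Qed.

Definition orthogonal_space (R : realType) d (u : 'rV[R]_d) :
    {vspace 'rV[R]_d} :=
  lker (linfun (dot u : 'rV[R]_d -> R^o)).

Lemma mem_orthogonal_space (R : realType) d (u v : 'rV[R]_d) :
  (v \in orthogonal_space u) = (dot u v == 0).
Proof. by rewrite memv_ker lfunE. Qed.

(** Rank-nullity: for nonzero [u] the form maps onto a line. *)
Lemma dim_orthogonal_space (R : realType) d (u : 'rV[R]_d) :
  u != 0 -> (\dim (orthogonal_space u)).+1 = d.
Proof.
move=> u0; have := limg_ker_dim (linfun (dot u : 'rV[R]_d -> R^o)) fullv.
rewrite capfv dimvf /dim /= mul1n => dE; apply: etrans dE.
suff -> : (linfun (dot u : 'rV[R]_d -> R^o) @: fullv)%VS = fullv.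
  by rewrite dimvf /dim /= addn1.
apply/eqP; rewrite eqEsubv subvf; apply/subvP => w _.
have -> : w = linfun (dot u : 'rV[R]_d -> R^o) ((w / dot u u) *: u).
  rewrite lfunE /= linearZ /= -[_ *: _]/(_ * _) divfK //.
  by rewrite gt_eqF // dot_self_gt0.
exact: memv_img (memvf _).
Qed.

(** * From acute angles to strict antipodality *)

Definition acute_set (R : realType) d (S : set 'rV[R]_d) :=
  forall x y z, S x -> S y -> S z -> y <> x -> z <> x -> y <> z ->
    0 < dot (y - x) (z - x).

(** The acute angle at [x] gives [0 < al], and the one at [y] gives [al < dot u u]. *)
Lemma acute_strictly_antipodal (R : realType) d (S : set 'rV[R]_d) :
  acute_set S -> strictly_antipodal S.
Proof.
move=> acS x y Sx Sy xy; set u := y - x.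
have u0 : u != 0 by rewrite subr_eq0; apply/eqP => /esym.
have D0 := dot_self_gt0 u0.
set V := orthogonal_space u.
exists (affine_subspace x V), (affine_subspace y V); split.
- by split; [exists x, V|exists y, V]; split=> //; exact: dim_orthogonal_space.
- by exists V, x, y.
- by split; rewrite /affine_subspace /= subrr mem0v.
move=> z Sz zx zy; set al := dot u (z - x).
have al0 : 0 < al by apply: acS => //; exact/nesym.
have beE : dot u (z - y) = al - dot u u.
  by rewrite /al -linearB /=; congr dot; rewrite /u opprB addrA subrK.
have be0 : al < dot u u.
  have : 0 < dot (x - y) (z - y) by apply: acS => //; exact/nesym.
  by rewrite -opprB dotC linearN /= dotC beE; lra.
set t := al / dot u u.
have tD : t * dot u u = al by rewrite divfK // gt_eqF.
split; rewrite /affine_subspace /= ?mem_orthogonal_space; last 2 first.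
- by apply/negP; rewrite gt_eqF.
- by apply/negP; rewrite beE lt_eqF // subr_lt0.
(* These are the points where the line through [z] in direction [u] meets the two hyperplanes. *)
exists (z - t *: u), (z + (1 - t) *: u), t; split.
- rewrite /= mem_orthogonal_space addrAC linearB linearZ /=.
  by rewrite -[_ *: _]/(_ * _) tD subrr.
- rewrite /= mem_orthogonal_space addrAC linearD linearZ /=.
  by rewrite -[_ *: _]/(_ * _) beE mulrBl tD mul1r; apply/eqP; lra.
- by rewrite divr_gt0 //= ltr_pdivrMr // mul1r.
- by apply/rowP => i; rewrite !mxE; ring.
Qed.

(** * Contribution of a single cube coordinate *)

(** A negative product needs a factor between two equal signs, such as [ex - ey] up to sign. Only
    the contraction [ex] of the corner can then cause a loss, and the other factor is at most 2 in
    absolute value. *)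
Lemma coord_ge (R : realFieldType) (ex ey ez : R) (bx by_ bz : bool) :
  0 <= ex <= 1 -> 0 <= ey <= 1 -> 0 <= ez <= 1 ->
  - (2 * ex) <= ((1 - ey) * (-1) ^+ by_ - (1 - ex) * (-1) ^+ bx) *
                ((1 - ez) * (-1) ^+ bz - (1 - ex) * (-1) ^+ bx).
Proof.
move=> /andP[? ?] /andP[? ?] /andP[? ?].
by case: bx by_ bz => [] [] []; rewrite ?expr1 ?expr0; nra.
Qed.

(** If [by_] equals [bx], the product is [(ey - ex) * (2 - ex - ez)], where the first factor is at
    least [3/4 * ey]. Otherwise both factors are close to 2 in absolute value. *)
Lemma coord_diff_ge (R : realFieldType) (ex ey ez : R) (bx by_ bz : bool) :
  0 <= ex -> 0 <= ez -> 4 * ex <= ey -> 4 * ez <= ey -> ey <= 1 / 8 ->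
  bz != bx ->
  ey <= ((1 - ey) * (-1) ^+ by_ - (1 - ex) * (-1) ^+ bx) *
        ((1 - ez) * (-1) ^+ bz - (1 - ex) * (-1) ^+ bx).
Proof.
move=> ? ? ? ? ?.
by case: bx by_ bz => [] [] [] // _; rewrite ?expr1 ?expr0; nra.
Qed.

Lemma dot_sub_row_mx (R : realType) n (a b c : R) (u v w : 'rV[R]_n) :
  dot (row_mx (const_mx b : 'rV_1) v - row_mx (const_mx a : 'rV_1) u)
      (row_mx (const_mx c : 'rV_1) w - row_mx (const_mx a : 'rV_1) u) =
  (b - a) * (c - a) + dot (v - u) (w - u).
Proof.
rewrite !opp_row_mx !add_row_mx /dot big_split_ord big_ord1 /=.
rewrite !row_mxEl !mxE; congr (_ + _).
by apply: eq_bigr => i _; rewrite !row_mxEr.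
Qed.

Lemma sum_ge_const (R : realFieldType) n (F : 'I_n -> R) (c : R) :
  (forall j, - c <= F j) -> - (n%:R * c) <= \sum_j F j.
Proof.
move=> lbF; rewrite -mulrN mulr_natl -[n in X in X <= _]card_ord -sumr_const.
exact: ler_sum.
Qed.

Lemma sum_ge_coord (R : realFieldType) n (F : 'I_n -> R) (c e : R) j0 :
  0 <= c -> (forall j, - c <= F j) -> e <= F j0 ->
  e - n%:R * c <= \sum_j F j.
Proof.
move=> c0 lbF Fj0; rewrite (bigD1 j0) //= lerD //.
(* A term 0 at [j0] restores the full index set, at the cost of one spare [c]. *)
have -> : \sum_(j | j != j0) F j = \sum_j (if j == j0 then 0 else F j).
  by rewrite big_mkcond; apply: eq_bigr => j _; case: eqP.
by apply: sum_ge_const => j; case: eqP => // _; rewrite oppr_le0.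
Qed.

(** * The lifted cube and its parameters *)

(** Chosen so that [ratio * height ^+ 2] is half of [shrink]. *)
Definition ratio (R : realType) n : R := (8 * n.+1%:R)^-1.

(** The enumeration rank is the order of the moves. The exponent starts at 1, which keeps all
    heights at most [ratio]. *)
Definition height (R : realType) n (v : {ffun 'I_n -> bool}) : R :=
  ratio R n ^+ (enum_rank v).+1.

(** A corner loses at most [2 * shrink] in each of [n] coordinates, hence less than half of
    [height ^+ 2] in total. *)
Definition shrink (R : realType) n (v : {ffun 'I_n -> bool}) : R :=
  height R v ^+ 2 / (4 * n.+1%:R).

Definition lifted_vertex (R : realType) n (v : {ffun 'I_n -> bool}) :
    'rV[R]_(1 + n) :=
  row_mx (const_mx (height R v)) (\row_j ((1 - shrink R v) * (-1) ^+ v j)).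

(** High enough for acute angles at the apex, yet [ratio] times this height is only 1/8. *)
Definition apex (R : realType) n : 'rV[R]_(1 + n) :=
  row_mx (const_mx n.+1%:R) 0.

Lemma ratio_eq (R : realType) n : 8 * n.+1%:R * ratio R n = 1.
Proof. by rewrite mulfV // mulf_neq0 ?pnatr_eq0. Qed.

Lemma ratio_gt0 (R : realType) n : 0 < ratio R n.
Proof. by rewrite invr_gt0 mulr_gt0 ?ltr0n. Qed.

Lemma ratio_le (R : realType) n : ratio R n <= 1 / 8.
Proof.
have := ratio_eq R n; have := ratio_gt0 R n.
have : 1 <= n.+1%:R :> R by rewrite ler1n.
nra.
Qed.

Lemma height_gt0 (R : realType) n (v : {ffun 'I_n -> bool}) : 0 < height R v.
Proof. by rewrite exprn_gt0 // ratio_gt0. Qed.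

Lemma height_le (R : realType) n (v : {ffun 'I_n -> bool}) :
  height R v <= ratio R n.
Proof.
rewrite /height exprS ler_piMr ?(ltW (ratio_gt0 _ _)) // exprn_ile1 //.
  exact/ltW/ratio_gt0.
by have := ratio_le R n; lra.
Qed.

(** Distinct vertices have distinct exponents, so one height is smaller by at least one factor
    [ratio]. *)
Lemma height_sep (R : realType) n (v w : {ffun 'I_n -> bool}) : v <> w ->
  height R v <= ratio R n * height R w \/ height R w <= ratio R n * height R v.
Proof.
have b0 := ltW (ratio_gt0 R n).
have b1 : ratio R n <= 1 by have := ratio_le R n; lra.
move=> vw; case: (ltngtP (enum_rank v) (enum_rank w)).
- by move=> lt; right; rewrite /height -exprS ler_wiXn2l.
- by move=> lt; left; rewrite /height -exprS ler_wiXn2l.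
- by move=> /ord_inj/enum_rank_inj.
Qed.

Lemma shrink_eq (R : realType) n (v : {ffun 'I_n -> bool}) :
  height R v ^+ 2 = 4 * n.+1%:R * shrink R v.
Proof. by rewrite mulrC divfK // mulf_neq0 ?pnatr_eq0. Qed.

Lemma shrink_ge0 (R : realType) n (v : {ffun 'I_n -> bool}) : 0 <= shrink R v.
Proof. by rewrite divr_ge0 ?sqr_ge0 // mulr_ge0. Qed.

Lemma shrink_le (R : realType) n (v : {ffun 'I_n -> bool}) :
  n.+1%:R * shrink R v <= 1 / 8.
Proof.
have := shrink_eq R v; have := height_gt0 R v; have := height_le R v.
have := ratio_le R n; nra.
Qed.

Lemma shrink_le_small (R : realType) n (v : {ffun 'I_n -> bool}) :
  shrink R v <= 1 / 8.
Proof.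
have := shrink_le R v; have := shrink_ge0 R v.
have : 1 <= n.+1%:R :> R by rewrite ler1n.
nra.
Qed.

Lemma ffun_neq_ex n (v w : {ffun 'I_n -> bool}) :
  v <> w -> exists j, v j != w j.
Proof.
move=> vw; apply/existsP; rewrite -negb_forall; apply/negP => /forallP e.
by apply: vw; apply/ffunP => j; apply/eqP.
Qed.

Lemma lifted_dot (R : realType) n (x y z : {ffun 'I_n -> bool}) :
  dot (lifted_vertex R y - lifted_vertex R x)
      (lifted_vertex R z - lifted_vertex R x) =
  (height R y - height R x) * (height R z - height R x) +
  \sum_j ((1 - shrink R y) * (-1) ^+ y j - (1 - shrink R x) * (-1) ^+ x j) *
         ((1 - shrink R z) * (-1) ^+ z j - (1 - shrink R x) * (-1) ^+ x j).
Proof.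
rewrite dot_sub_row_mx; congr (_ + _).
by apply: eq_bigr => j _; rewrite !mxE.
Qed.

(** * Angles between lifted vertices *)

(** The heights contribute at least 49/64 of [height R x ^+ 2], and the coordinates lose at most
    half of it. *)
Lemma acute_at_highest (R : realType) n (x y z : {ffun 'I_n -> bool}) :
  height R y <= ratio R n * height R x -> height R z <= ratio R n * height R x ->
  0 < dot (lifted_vertex R y - lifted_vertex R x)
          (lifted_vertex R z - lifted_vertex R x).
Proof.
move=> hy hz; rewrite lifted_dot.
have [b0 b1 bE hx0] :=
  And4 (ratio_gt0 R n) (ratio_le R n) (ratio_eq R n) (height_gt0 R x).
have eE := shrink_eq R x.
have [ex0 ey0 ez0] := And3 (shrink_ge0 R x) (shrink_ge0 R y) (shrink_ge0 R z).
have [ex1 ey1 ez1] :=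
  And3 (shrink_le_small R x) (shrink_le_small R y) (shrink_le_small R z).
have /sum_ge_const S : forall j, - (2 * shrink R x) <=
    ((1 - shrink R y) * (-1) ^+ y j - (1 - shrink R x) * (-1) ^+ x j) *
    ((1 - shrink R z) * (-1) ^+ z j - (1 - shrink R x) * (-1) ^+ x j).
  by move=> j; apply: coord_ge; lra.
apply: lt_le_trans (lerD (lexx _) S).
have : (7 / 8 * height R x) ^+ 2 <=
    (height R y - height R x) * (height R z - height R x).
  rewrite -[leRHS]mulrNN !opprB expr2.
  by rewrite ler_pM //; nra.
(* Splitting [n.+1] makes [4 * (n + 1) * shrink] comparable with the loss [n * (2 * shrink)]. *)
move: eE; rewrite -natr1; nra.
Qed.

(** A coordinate where [x] and [z] differ gains [shrink R y]. The heights cost at most half of this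
    and the other coordinates at most a quarter, so a positive amount remains. *)
Lemma acute_next_to_highest (R : realType) n (x y z : {ffun 'I_n -> bool}) :
  x <> z ->
  height R x <= ratio R n * height R y -> height R z <= ratio R n * height R y ->
  0 < dot (lifted_vertex R y - lifted_vertex R x)
          (lifted_vertex R z - lifted_vertex R x).
Proof.
move=> /nesym/ffun_neq_ex[j0 xzj] hx hz; rewrite lifted_dot.
have [b0 b1 bE hy0] :=
  And4 (ratio_gt0 R n) (ratio_le R n) (ratio_eq R n) (height_gt0 R y).
have [hx0 hz0] := conj (height_gt0 R x) (height_gt0 R z).
have eyE := shrink_eq R y.
have [ex0 ey0 ez0] := And3 (shrink_ge0 R x) (shrink_ge0 R y) (shrink_ge0 R z).
have [ex1 ey1 ez1] :=
  And3 (shrink_le_small R x) (shrink_le_small R y) (shrink_le_small R z).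
have M1 : 1 <= n.+1%:R :> R by rewrite ler1n.
have small (w : {ffun 'I_n -> bool}) : height R w <= ratio R n * height R y ->
    shrink R w <= ratio R n ^+ 2 * shrink R y.
  move=> hw; have hw0 := height_gt0 R w.
  rewrite /shrink [leRHS]mulrA -exprMn ler_pM2r ?invr_gt0 ?mulr_gt0 ?ltr0n //.
  by rewrite lerXn2r // nnegrE ltW // mulr_gt0.
have [sx sz] := conj (small _ hx) (small _ hz).
(* This yields the factor 4 between contractions required by [coord_diff_ge]. *)
have b2 : ratio R n ^+ 2 <= 1 / 64 by nra.
have /(@sum_ge_coord _ _ _ (2 * shrink R x) (shrink R y) j0) S : forall j,
    - (2 * shrink R x) <=
    ((1 - shrink R y) * (-1) ^+ y j - (1 - shrink R x) * (-1) ^+ x j) *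
    ((1 - shrink R z) * (-1) ^+ z j - (1 - shrink R x) * (-1) ^+ x j).
  by move=> j; apply: coord_ge; lra.
have {S} := S _ _; rewrite mulr_ge0 // => /(_ isT).
have ds : shrink R y <=
    ((1 - shrink R y) * (-1) ^+ y j0 - (1 - shrink R x) * (-1) ^+ x j0) *
    ((1 - shrink R z) * (-1) ^+ z j0 - (1 - shrink R x) * (-1) ^+ x j0).
  by apply: coord_diff_ge => //; nra.
move=> /(_ ds) S; apply: lt_le_trans (lerD (lexx _) S).
have hh : - (ratio R n * height R y ^+ 2) <=
    (height R y - height R x) * (height R z - height R x).
  have yx0 : 0 <= height R y - height R x by nra.
  have zx0 : - (ratio R n * height R y) <= height R z - height R x by lra.
  apply: le_trans (ler_wpM2l yx0 zx0); rewrite mulrN lerN2 mulrBl expr2.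
  have : 0 < height R x * (ratio R n * height R y) by rewrite !mulr_gt0.
  lra.
have hE : ratio R n * height R y ^+ 2 = shrink R y / 2.
  have -> : ratio R n * height R y ^+ 2 =
      (8 * n.+1%:R * ratio R n) * shrink R y / 2.
    by rewrite eyE; field.
  by rewrite bE mul1r.
have nE : n%:R * (2 * shrink R x) <= shrink R y / 4.
  have : n%:R * (2 * shrink R x) <=
      n.+1%:R * (2 * (ratio R n ^+ 2 * shrink R y)).
    by apply: ler_pM; [|lra|rewrite ler_nat|lra].
  have -> : n.+1%:R * (2 * (ratio R n ^+ 2 * shrink R y)) =
    (8 * n.+1%:R * ratio R n) * (ratio R n * shrink R y) / 4 by field.
  rewrite bE mul1r => nx; apply: le_trans nx _.
  by rewrite ler_pM2r ?invr_gt0 //; nra.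
have : 0 < shrink R y by rewrite divr_gt0 ?exprn_gt0 // mulr_gt0 ?ltr0n.
lra.
Qed.

(** Cases on which of the three vertices is highest: the corner, or the end of one arm, up to
    exchanging the arms by [dotC]. *)
Lemma acute_lifted (R : realType) n (x y z : {ffun 'I_n -> bool}) :
  y <> x -> z <> x -> y <> z ->
  0 < dot (lifted_vertex R y - lifted_vertex R x)
          (lifted_vertex R z - lifted_vertex R x).
Proof.
have bl (a c : {ffun 'I_n -> bool}) :
    height R a <= ratio R n * height R c -> height R a <= height R c.
  have := ratio_le R n; have := height_gt0 R c; have := height_gt0 R a; nra.
have tr (a b c : {ffun 'I_n -> bool}) : height R a <= ratio R n * height R b ->
    height R b <= ratio R n * height R c -> height R a <= ratio R n * height R c.
  by move=> ab /bl bc; apply: le_trans ab _; rewrite ler_pM2l // ratio_gt0.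
move=> yx zx yz.
case: (height_sep R yx) => hyx; case: (height_sep R zx) => hzx.
- exact: acute_at_highest.
- rewrite dotC.
  exact: acute_next_to_highest (nesym yx) hzx (tr _ _ _ hyx hzx).
- exact: acute_next_to_highest (nesym zx) hyx (tr _ _ _ hzx hyx).
case: (height_sep R yz) => hyz.
- by rewrite dotC; exact: acute_next_to_highest (nesym yx) hzx hyz.
- exact: acute_next_to_highest (nesym zx) hyx hyz.
Qed.

(** * Angles involving the apex *)

(** A coordinate where [x] and [y] differ gives at least 1. The other coordinates and the heights
    lose at most 1/8 each in total. *)
Lemma acute_at_vertex_apex (R : realType) n (x y : {ffun 'I_n -> bool}) :
  y <> x ->
  0 < dot (lifted_vertex R y - lifted_vertex R x)
          (apex R n - lifted_vertex R x).
Proof.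
move=> /ffun_neq_ex[j0 xyj].
rewrite dot_sub_row_mx.
have [b0 b1 bE] := And3 (ratio_gt0 R n) (ratio_le R n) (ratio_eq R n).
have [hx0 hy0] := conj (height_gt0 R x) (height_gt0 R y).
have [hx1 hy1] := conj (height_le R x) (height_le R y).
have [ex0 ey0] := conj (shrink_ge0 R x) (shrink_ge0 R y).
have [ex1 ey1] := conj (shrink_le_small R x) (shrink_le_small R y).
have ex2 := shrink_le R x.
have M1 : 1 <= n.+1%:R :> R by rewrite ler1n.
have F j : (\row_k ((1 - shrink R y) * (-1) ^+ y k) -
   \row_k ((1 - shrink R x) * (-1) ^+ x k)) 0 j *
   (0 - \row_k ((1 - shrink R x) * (-1) ^+ x k)) 0 j =
   ((1 - shrink R y) * (-1) ^+ y j - (1 - shrink R x) * (-1) ^+ x j) *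
   (0 - (1 - shrink R x) * (-1) ^+ x j) by rewrite !mxE.
have /(@sum_ge_coord _ _ _ (shrink R x) 1 j0 ex0) S : forall j, - shrink R x <=
   ((1 - shrink R y) * (-1) ^+ y j - (1 - shrink R x) * (-1) ^+ x j) *
   (0 - (1 - shrink R x) * (-1) ^+ x j).
  by move=> j; case: (x j) (y j) => [] []; rewrite ?expr1 ?expr0; nra.
have {}S : 1 - n%:R * shrink R x <=
    dot (\row_k ((1 - shrink R y) * (-1) ^+ y k) -
         \row_k ((1 - shrink R x) * (-1) ^+ x k))
        (0 - \row_k ((1 - shrink R x) * (-1) ^+ x k)).
  rewrite /dot (eq_bigr _ (fun j _ => F j)); apply: S.
  by move: xyj; case: (x j0) (y j0) => [] [] // _; rewrite ?expr1 ?expr0; nra.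
apply: lt_le_trans (lerD (lexx _) S).
have hh : - (1 / 8) <=
    (height R y - height R x) * (n.+1%:R - height R x) by nra.
move: ex2; rewrite -natr1; nra.
Qed.

(** The vertical part is at least [(n + 7/8) ^+ 2], which exceeds the worst loss [n] of the
    coordinates. *)
Lemma acute_at_apex (R : realType) n (y z : {ffun 'I_n -> bool}) :
  0 < dot (lifted_vertex R y - apex R n) (lifted_vertex R z - apex R n).
Proof.
rewrite dot_sub_row_mx.
have b1 := ratio_le R n.
have [hz1 hy1] := conj (height_le R z) (height_le R y).
have [ez0 ey0] := conj (shrink_ge0 R z) (shrink_ge0 R y).
have [ez1 ey1] := conj (shrink_le_small R z) (shrink_le_small R y).
have n0 : 0 <= n%:R :> R by [].
have F j : (\row_k ((1 - shrink R y) * (-1) ^+ y k) - 0) 0 j *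
   (\row_k ((1 - shrink R z) * (-1) ^+ z k) - 0) 0 j =
   ((1 - shrink R y) * (-1) ^+ y j) * ((1 - shrink R z) * (-1) ^+ z j).
  by rewrite !mxE !subr0.
rewrite /dot (eq_bigr _ (fun j _ => F j)).
have /sum_ge_const S : forall j,
    -1 <= ((1 - shrink R y) * (-1) ^+ y j) * ((1 - shrink R z) * (-1) ^+ z j).
  by move=> j; case: (y j) (z j) => [] []; rewrite ?expr1 ?expr0; nra.
apply: lt_le_trans (lerD (lexx _) S).
rewrite -natr1; nra.
Qed.

(** * The configuration and its cardinality *)

(** [None] stands for the apex, so the index type has [2 ^ n + 1] elements. *)
Definition config (R : realType) n (o : option {ffun 'I_n -> bool}) :
    'rV[R]_(1 + n) :=
  oapp (@lifted_vertex R n) (apex R n) o.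

(** The first coordinate alone separates the points: vertex heights differ by [height_sep] and stay
    below the apex. *)
Lemma config_inj (R : realType) n : injective (@config R n).
Proof.
have ap v : apex R n <> lifted_vertex R v.
  move=> /eq_row_mx[/matrixP/(_ 0 0) + _]; rewrite !mxE => hE.
  have := height_le R v; have := ratio_le R n.
  have : 1 <= n.+1%:R :> R by rewrite ler1n.
  lra.
move=> [v|] [w|] //=; last 2 first.
- by move/esym/ap.
- by move/ap.
move=> /eq_row_mx[/matrixP/(_ 0 0) + _]; rewrite !mxE => hE.
have [->//|/eqP vw] := eqVneq v w.
exfalso; have := ratio_le R n; have := height_gt0 R w.
case: (height_sep R vw); rewrite hE; nra.
Qed.

Lemma acute_config (R : realType) n : acute_set (range (@config R n)).
Proof.
move=> _ _ _ [x _ <-] [y _ <-] [z _ <-].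
case: x y z => [x|] [y|] [z|] //= yx zx yz.
- by apply: acute_lifted => e; [apply: yx|apply: zx|apply: yz]; rewrite e.
- by apply: acute_at_vertex_apex => e; apply: yx; rewrite e.
- by rewrite dotC; apply: acute_at_vertex_apex => e; apply: zx; rewrite e.
- exact: acute_at_apex.
Qed.
Lemma card_range_inj (T : finType) (U : Type) (f : T -> U) :
  injective f -> (range f #= `I_#|T|)%card.
Proof.
move=> finj.
have -> : range f = range (f \o @enum_val T xpredT).
  apply/seteqP; split=> _ [x _ <-] /=; last by exists (enum_val x).
  by exists (enum_rank x); rewrite //= enum_rankK.
have /inj_card_eq/card_eq_trans :
    {in [set: 'I_#|T|] &, injective (f \o @enum_val T xpredT)}.
  by move=> i j _ _ /finj/enum_val_inj.
by apply; rewrite card_eq_sym card_II.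
Qed.

Theorem corollary2 (R : realType) (d : nat) (hd : (1 <= d)%N) :
  exists S : set 'rV[R]_d,
    (S #= `I_(2 ^ (d - 1) + 1))%card /\ strictly_antipodal S.
Proof.
case: d hd => // n _; exists (range (@config R n)); split.
- have := card_range_inj (@config_inj R n).
  by rewrite card_option card_ffun card_bool card_ord subn1 addn1.
- exact/acute_strictly_antipodal/acute_config.
Qed.
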